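(* Let $q\geq 3$ be a natural number and let $U$ be a subset of the vertices of the graph $H(2,q,2)$ with $|U|\geq 2q$. Then the VC-dimension of $(U,n(U))$ is at least $2$. Moreover, this bound is tight: for every $q\ge 3$ there is a subset $U$ of the vertices of $H(2,q,2)$ with $|U|=2q-1$ such that the VC-dimension of $(U,n(U))$ is strictly less than $2$.
   Context: The graph $H(2,q,2)$ has vertex set $\mathbb Z_q^2$, with two vertices adjacent if and only if they differ in exactly two coordinates (i.e. in both coordinates). For a vertex $x$, $n(x)$ denotes its neighborhood in this graph, the set of vertices adjacent to $x$ (so $x\notin n(x)$), and for a set $U$ of vertices $n(U)=\{n(u):u\in U\}$. A set $W\subseteq U$ is shattered by $n(U)$ if for every $S\subseteq W$ there is $u\in U$ with $n(u)\cap W=S$. The VC-dimension of $(U,n(U))$ is the size of the largest $W\subseteq U$ that is shattered by $n(U)$. *)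

(* Defs.v *)
From mathcomp Require Import all_boot all_algebra.

Set Implicit Arguments.
Unset Strict Implicit.
Unset Printing Implicit Defensive.

(* 'Z_q is the ring of integers mod q only when 1 < q. *)
Definition Hvertex (d q : nat) : finType := {ffun 'I_d -> 'Z_q}.

(* Adjacency relation of the graph H(d, q, t) on Z_q^d. *)
Definition Hadj (d q t : nat) : rel (Hvertex d q) :=
  fun x y => #|[set i : 'I_d | x i != y i]| == t.

Section VC.

Variable V : finType.

Definition nbhd (e : rel V) (x : V) : {set V} := [set y | e x y].

Definition nbhds (e : rel V) (U : {set V}) : {set {set V}} :=
  [set nbhd e u | u in U].

Definition shattered (F : {set {set V}}) (W : {set V}) : bool :=
  [forall S : {set V}, (S \subset W) ==> [exists A in F, A :&: W == S]].

(* The maximum over an empty family is 0; this only happens when F is empty,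
   since otherwise set0 is shattered. *)
Definition VCdim (U : {set V}) (F : {set {set V}}) : nat :=
  \max_(W : {set V} | (W \subset U) && shattered F W) #|W|.

End VC.

(* Main.v *)
Require Import Defs.
From mathcomp Require Import all_boot all_algebra.

(** View a set of vertices of H(2,q,2) as the edge set E of a bipartite graph
    between rows and columns: adjacency in H(2,q,2) is disjointness of edges.
    A 3-edge path together with an edge disjoint from it yields a shattered
    pair, and so does K_{2,2} plus a further edge at one of its vertices.  If
    |E| >= 2q then some edge rc has both ends of degree at least 2.  Were no
    pair shattered, every edge would meet every 3-edge path with middle rc;
    depending on whether r and c have degree 2 or at least 3, this confines E
    to a cross (of size 2q - 1), to two parallel lines, or to rc plus a cross;
    in the last two cases E must fill that set, which contains one of the two
    configurations.  A cross itself shows that the bound is tight. *)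

(** * Shattered pairs and graph isomorphisms *)

(** A subset of a shattered set is shattered, so only pairs matter: all four adjacency patterns on
    [w1] and [w2] must occur. *)
Lemma VCdim_ge2P (V : finType) (e : rel V) (U : {set V}) :
  reflect (exists w1 w2, [/\ w1 \in U, w2 \in U, w1 != w2 &
             forall b1 b2, exists u, [/\ u \in U, e u w1 = b1 & e u w2 = b2]])
          (1 < VCdim U (nbhds e U)).
Proof.
apply: (iffP idP) => [|[w1 [w2 [w1U w2U neq_w shat]]]].
  rewrite ltnNge => /bigmax_leqP nbig.
  have [W WU_sh] : exists W : {set V},
      [&& W \subset U, shattered (nbhds e U) W & 1 < #|W|].
    apply/existsP; apply: contraT => /existsPn noW; case: nbig => W /andP[WU sW].
    by have := noW W; rewrite WU sW /= -leqNgt.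
  case/and3P: WU_sh => /subsetP WU /forallP sW /card_gt1P[w1 [w2 [w1W w2W nw]]].
  exists w1, w2; split; rewrite ?WU // => b1 b2.
  (* The trace containing [w1] exactly when [b1], [w2] exactly when [b2], and nothing else. *)
  pose S := [set w in W | ((w == w1) && b1) || ((w == w2) && b2)].
  have SW : S \subset W by apply/subsetP => w; rewrite inE => /andP[].
  have /existsP[A /andP[/imsetP[u uU ->] /eqP defS]] := implyP (sW S) SW.
  exists u; split=> //.
    have := congr1 (fun X : {set V} => w1 \in X) defS.
    by rewrite !inE w1W eqxx (negPf nw) andbT /= orbF.
  have := congr1 (fun X : {set V} => w2 \in X) defS.
  by rewrite !inE w2W eqxx eq_sym (negPf nw) andbT.
have <- : #|[set w1; w2]| = 2 by rewrite cards2 neq_w.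
apply: (@leq_bigmax_cond _ _ (fun W : {set V} => #|W|)).
apply/andP; split; first by apply/subsetP => w /set2P[] ->.
apply/forallP => S; apply/implyP => /subsetP SW.
have [u [uU e1 e2]] := shat (w1 \in S) (w2 \in S).
apply/existsP; exists (nbhd e u); rewrite imset_f //=.
apply/eqP/setP => w; rewrite !inE.
have [->|nw1] := eqVneq w w1; first by rewrite e1 andbT.
have [->|nw2] := eqVneq w w2; first by rewrite e2 andbT.
rewrite andbF; apply/esym/negP => /SW.
by rewrite !inE (negPf nw1) (negPf nw2).
Qed.

(** An isomorphism carries shattered pairs over. This serves to pass between H(2,q,2) and the grid,
    and to exchange rows with columns. *)
Lemma VCdim_ge2_preim (V V' : finType) (e : rel V) (e' : rel V')
    (f : V -> V') (g : V' -> V) (U : {set V'}) :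
    cancel f g -> cancel g f -> (forall x y, e' (f x) (f y) = e x y) ->
  (1 < VCdim (f @^-1: U) (nbhds e (f @^-1: U))) = (1 < VCdim U (nbhds e' U)).
Proof.
move=> fK gK fe; apply/VCdim_ge2P/VCdim_ge2P => -[w1 [w2 []]].
  rewrite !inE => w1U w2U nw sh; exists (f w1), (f w2).
  split=> // [|b1 b2]; first by rewrite (can_eq fK).
  by have [u []] := sh b1 b2; rewrite inE; exists (f u); rewrite !fe.
move=> w1U w2U nw sh; exists (g w1), (g w2).
rewrite !inE !gK (can_eq gK); split=> // b1 b2.
by have [u []] := sh b1 b2; exists (g u); rewrite inE -!fe !gK.
Qed.

(** * Crosses in a grid *)

Definition diffboth {R C : finType} : rel (R * C) :=
  fun x y => (x.1 != y.1) && (x.2 != y.2).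

Definition cross {R C : finType} (r : R) (c : C) : {set R * C} :=
  [set p | (p.1 == r) || (p.2 == c)].

Lemma card_cross (R C : finType) (r : R) (c : C) :
  #|cross r c| = (#|R| + #|C|).-1.
Proof.
have -> : cross r c = setX [set r] [set: C] :|: setX [set: R] [set c].
  by apply/setP => -[x y]; rewrite !inE /= andbT.
have := cardsUI (setX [set r] [set: C]) (setX [set: R] [set c]).
have -> : setX [set r] [set: C] :&: setX [set: R] [set c] = setX [set r] [set c].
  by apply/setP => -[x y]; rewrite !inE /= andbT.
by rewrite !cardsX !cards1 !cardsT !mul1n !muln1 addn1 addnC => <-.
Qed.

(** Suppose [w1] and [w2] form a shattered pair. A vertex of the cross adjacent to both lies on one
    arm, say row [r], and forces both onto column [c]. A vertex of the cross adjacent to [w1] is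
    then off column [c], hence on row [r], hence adjacent to [w2] too: the pattern true-false cannot
    occur. *)
Lemma VCdim_cross_lt2 (R C : finType) (r : R) (c : C) :
  VCdim (cross r c) (nbhds diffboth (cross r c)) < 2.
Proof.
rewrite ltnNge; apply/VCdim_ge2P => -[[x1 y1] [[x2 y2] []]].
rewrite !inE /= => w1 w2 nw sh.
have [[x y] []] := sh true true; have [[x' y'] []] := sh true false.
rewrite !inE /diffboth /= => u' /andP[xx1' yy1'] /negbT; rewrite negb_and !negbK.
move=> e2 u /andP[xx1 yy1] /andP[xx2 yy2].
case/orP: u => [/eqP ex|/eqP ey]; subst.
  move: w1 w2; rewrite (eq_sym x1) (negPf xx1) (eq_sym x2) (negPf xx2) /=.
  move=> /eqP ? /eqP ?; subst.
  move: u' e2; rewrite (negPf yy1') orbF => /eqP->.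
  by rewrite (negPf xx2).
move: w1 w2; rewrite (eq_sym y1) (negPf yy1) (eq_sym y2) (negPf yy2) !orbF.
move=> /eqP ? /eqP ?; subst.
move: u' e2; rewrite (negPf xx1') /= => /eqP->.
by rewrite (negPf yy2).
Qed.

(** * Shattered configurations in bipartite graphs *)

Section Grid.

Variables R C : finType.
Implicit Types (E : {set R * C}) (r : R) (c : C).

Local Notation shat E := (1 < VCdim E (nbhds diffboth E)).

Lemma shat_path_edge E r r1 r2 c c1 c2 :
    (r, c1) \in E -> (r, c) \in E -> (r1, c) \in E -> (r2, c2) \in E ->
    r1 != r -> c1 != c -> r2 != r -> r2 != r1 -> c2 != c -> c2 != c1 ->
  shat E.
Proof.
move=> e1 e2 e3 e4 nr nc nr2 nr21 nc2 nc21; apply/VCdim_ge2P.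
(* The shattered pair consists of the end edges of the path. The disjoint edge is adjacent to both,
   each end edge to the other only, the middle edge to neither. *)
exists (r, c1), (r1, c); split=> //.
  by rewrite xpair_eqE negb_and nc orbT.
rewrite /diffboth; case=> -[];
  [exists (r2, c2)|exists (r1, c)|exists (r, c1)|exists (r, c)].
- by rewrite /= nr2 nr21 nc2 nc21.
- by rewrite /= eqxx nr eq_sym nc.
- by rewrite /= eqxx eq_sym nr nc.
- by rewrite /= !eqxx andbF.
Qed.

Lemma shat_two_rows E r r1 :
    r1 != r -> 2 < #|C| -> 2 * #|C| <= #|E| ->
    (forall p, p \in E -> (p.1 == r) || (p.1 == r1)) ->
  shat E.
Proof.
move=> nr C3 cE sE.
(* By cardinality [E] fills both rows, which provides K_{2,2} and a further edge [(r1, y3)]. *)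
have defE : E = setX [set r; r1] [set: C].
  apply/eqP; rewrite eqEcard cardsX cards2 eq_sym nr cardsT cE andbT.
  by apply/subsetP => p /sE; rewrite !inE andbT.
have /card_gt2P[y1 [y2 [y3 [_ [n12 n23 n31]]]]] := C3.
have inE' x y : x \in [:: r; r1] -> (x, y) \in E by rewrite defE !inE andbT.
apply/VCdim_ge2P; exists (r, y1), (r, y2); split; rewrite ?inE' ?inE ?eqxx //.
  by rewrite xpair_eqE eqxx n12.
rewrite /diffboth; case=> -[];
  [exists (r1, y3)|exists (r1, y2)|exists (r1, y1)|exists (r, y1)];
  rewrite inE' ?inE ?eqxx ?orbT //= ?nr ?eqxx //=.
- by rewrite n31 eq_sym n23.
- by rewrite eq_sym n12.
Qed.

Lemma ex_edge_deg_ge2 E : 0 < #|C| -> #|R| + #|C| <= #|E| ->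
  exists r c r1 c1, [/\ (r, c) \in E, (r, c1) \in E, (r1, c) \in E, r1 != r & c1 != c].
Proof.
move=> C0 cE.
(* The edges that are alone in their row, respectively alone in their column. It is enough that
   together they do not exhaust [E]. *)
pose E1 := [set p in E | [forall q in E, (q.1 == p.1) ==> (q == p)]].
pose E2 := [set p in E | [forall q in E, (q.2 == p.2) ==> (q == p)]].
have c2 : #|E2| <= #|C|.
  rewrite -(@card_in_imset _ _ snd) ?max_card // => p q.
  rewrite !inE => /andP[pE _] /andP[_ /forall_inP/(_ _ pE)] /[swap] ->.
  by rewrite eqxx => /eqP.
have c1 : #|E1| < #|R|.
  (* As [E] has more than [#|R|] edges, some row contains two of them, and no edge of [E1] lies in
     that row. This gives the strict inequality that the count needs. *)
  have [r0 nr0] : exists r0, r0 \notin fst @: E1.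
    have /dinjectivePn[p pE [q /andP[/= nqp qE] epq]] : ~~ dinjectiveb fst (mem E).
      apply/dinjectiveP => /card_in_imset cfE.
      have := max_card (fst @: mem E); rewrite cfE => /(leq_trans cE).
      by rewrite leqNgt -[ltnLHS]addn0 ltn_add2l C0.
    exists p.1; apply/imsetP => -[t]; rewrite inE => /andP[tE /forall_inP tu] ept.
    have /implyP := tu _ pE; rewrite ept eqxx => /(_ isT)/eqP ep.
    have /implyP := tu _ qE; rewrite -epq ept eqxx => /(_ isT)/eqP eq.
    by rewrite ep eq eqxx in nqp.
  rewrite -(@card_in_imset _ _ fst); last first.
    move=> p q; rewrite !inE => /andP[pE _] /andP[_ /forall_inP/(_ _ pE)] /[swap] ->.
    by rewrite eqxx => /eqP.
  rewrite -[#|R|]cardsT; apply/proper_card/properP; split; first exact: subsetT.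
  by exists r0.
have /subsetPn[[r c] rcE] : ~~ (E \subset E1 :|: E2).
  apply/negP => /subset_leq_card/leq_trans/(_ (leq_card_setU _ _)).
  by rewrite leqNgt (leq_trans _ cE) // -addSn leq_add.
rewrite !inE rcE negb_or /= => /andP[] /forall_inPn[[x y] xyE] /=.
rewrite negb_imply => /andP[/eqP ex n1] /forall_inPn[[x' y'] xyE'] /=.
rewrite negb_imply => /andP[/eqP ey n2].
move: n1 n2 xyE xyE'; rewrite ex ey !xpair_eqE !eqxx andbT => *.
by exists r, c, x', y.
Qed.

Lemma shat_confined E r r1 c c1 :
    ~~ shat E -> (r, c1) \in E -> (r, c) \in E -> (r1, c) \in E ->
    r1 != r -> c1 != c ->
  forall x y, (x, y) \in E -> [|| x == r, x == r1, y == c | y == c1].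
Proof.
move=> nsh e1 e2 e3 nr nc x y exy; apply: contraR nsh.
rewrite !negb_or => /and4P[n1 n2 n3 n4].
exact: (@shat_path_edge E r r1 x c c1 y).
Qed.

End Grid.

Lemma shat_two_cols (R C : finType) (E : {set R * C}) (c c1 : C) :
    c1 != c -> 2 < #|R| -> 2 * #|R| <= #|E| ->
    (forall p, p \in E -> (p.2 == c) || (p.2 == c1)) ->
  1 < VCdim E (nbhds diffboth E).
Proof.
move=> nc R3 cE sE; pose sw A B (p : A * B) := (p.2, p.1).
have swK A B : cancel (sw A B) (sw B A) by case.
rewrite -(@VCdim_ge2_preim _ _ (@diffboth C R) _ (sw C R) (sw R C) E (swK _ _) (swK _ _));
  last first.
  by move=> x y; rewrite /diffboth andbC.
apply: (@shat_two_rows _ _ _ c c1) => // [|p]; last by rewrite inE => /sE.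
rewrite on_card_preimset //.
by exists (sw R C) => x _; apply: swK.
Qed.

Lemma VCdim_grid_ge2 (R C : finType) (E : {set R * C}) :
    2 < #|R| -> #|C| = #|R| -> 2 * #|R| <= #|E| ->
  1 < VCdim E (nbhds diffboth E).
Proof.
move=> R3 cC cE; have cRC : #|R| + #|C| <= #|E| by rewrite cC addnn -mul2n.
have C0 : 0 < #|C| by rewrite cC (leq_trans _ R3).
have [r [c [r1 [c1 [erc erc1 er1c nr nc]]]]] := @ex_edge_deg_ge2 _ _ E C0 cRC.
have not_cross r' c' : ~~ (E \subset cross r' c').
  apply/negP => /subset_leq_card; rewrite card_cross leqNgt prednK ?cRC //.
  by rewrite addn_gt0 C0 orbT.
apply: contraT => nsh; have conf := @shat_confined _ _ E _ _ _ _ nsh.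
(* Four cases: does [r] have a third edge [(r, c2)], and does [c] have a third edge [(r2, c)]? *)
have [/existsP[c2 /and3P[nc2 nc21 erc2]]|/existsPn noc2] :=
  boolP [exists c2, [&& c2 != c, c2 != c1 & (r, c2) \in E]];
have [/existsP[r2 /and3P[nr2 nr21 er2c]]|/existsPn nor2] :=
  boolP [exists r2, [&& r2 != r, r2 != r1 & (r2, c) \in E]].
(* Both do. An edge off [cross r c] would have to meet all four paths with middle [(r, c)], hence
   contain both [c1] and [c2], or both [r1] and [r2]. *)
- case/negP: (not_cross r c); apply/subsetP => -[x y] xyE; rewrite inE /=.
  have := conf _ _ _ _ erc1 erc er1c nr nc _ _ xyE.
  have := conf _ _ _ _ erc1 erc er2c nr2 nc _ _ xyE.
  have := conf _ _ _ _ erc2 erc er1c nr nc2 _ _ xyE.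
  have := conf _ _ _ _ erc2 erc er2c nr2 nc2 _ _ xyE.
  have [//|_] := eqVneq x r; have [//|_] := eqVneq y c => /=.
  have [->|_] := eqVneq x r1.
    by rewrite (eq_sym r1) (negPf nr21) => /eqP->; rewrite (negPf nc21).
  have [->|_] := eqVneq y c1; first by rewrite (eq_sym c1) (negPf nc21).
  by move=> /orP[] /eqP->; rewrite ?(negPf nr21) ?(negPf nc21).
(* Only [r] does. An edge off rows [r] and [r1] must meet the paths through [c1] and through [c2],
   so it ends at [c], which has no third edge. *)
- case/negP: nsh; apply: (@shat_two_rows _ _ E r r1); rewrite ?cC // => -[x y] xyE /=.
  have := conf _ _ _ _ erc1 erc er1c nr nc _ _ xyE.
  have := conf _ _ _ _ erc2 erc er1c nr nc2 _ _ xyE.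
  have := nor2 x; have [//|_] := eqVneq x r; have [//|_] := eqVneq x r1 => /=.
  have [<-|_] := eqVneq y c => /=; first by rewrite xyE.
  by move=> _ /eqP-> /eqP; case: eqP nc21.
- case/negP: nsh; apply: (@shat_two_cols _ _ E c c1) => // -[x y] xyE /=.
  have := conf _ _ _ _ erc1 erc er1c nr nc _ _ xyE.
  have := conf _ _ _ _ erc1 erc er2c nr2 nc _ _ xyE.
  have := noc2 y; have [//|_] := eqVneq y c; have [//|_] := eqVneq y c1 => /=.
  have [<-|_] := eqVneq x r => /=; first by rewrite xyE.
  by move=> _; rewrite !orbF => /eqP-> /eqP; case: eqP nr21.
(* Both ends of [(r, c)] have degree 2. The bound has size [#|R| + #|C|], so [E] must fill it. *)
have sE : E \subset (r, c) |: cross r1 c1.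
  apply/subsetP => -[x y] xyE; rewrite !inE /= xpair_eqE.
  have := conf _ _ _ _ erc1 erc er1c nr nc _ _ xyE.
  move: (noc2 y) (nor2 x) xyE.
  have [_|_] := eqVneq x r1; first by rewrite !orbT.
  have [_|_] := eqVneq y c1; first by rewrite !orbT.
  have [->|_] := eqVneq x r; have [->|_] := eqVneq y c => //=.
    by move=> /negPf->.
  by move=> _ /negPf->.
have defE : E = (r, c) |: cross r1 c1.
  apply/eqP; rewrite eqEcard sE /= cardsU1 card_cross.
  rewrite (leq_trans _ cRC) // -[leqRHS]prednK ?addn_gt0 ?C0 ?orbT //.
  by rewrite -[leqRHS]add1n leq_add2r leq_b1.
have inE' x y : (x == r1) || (y == c1) -> (x, y) \in E.
  by rewrite defE !inE => ->; rewrite orbT.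
(* A third row [r2] and a third column [c2] give the path [(r1, c2)], [(r1, c1)], [(r2, c1)] inside
   [cross r1 c1], disjoint from the edge [(r, c)]. *)
have /card_gt0P[r2] : 0 < #|~: [set r; r1]|.
  by rewrite -(ltn_add2l #|[set r; r1]|) cardsC cards2 addn0 eq_sym nr.
have /card_gt0P[c2] : 0 < #|~: [set c; c1]|.
  by rewrite -(ltn_add2l #|[set c; c1]|) cardsC cards2 addn0 eq_sym nc cC.
rewrite !inE !negb_or => /andP[nc2 nc21] /andP[nr2 nr21].
case/negP: nsh; apply: (@shat_path_edge _ _ E r1 r2 r c1 c2 c) => //;
  by rewrite 1?eq_sym // inE' ?eqxx ?orbT.
Qed.

(** * Transfer to H(2,q,2) *)

Definition hpair (q : nat) (p : 'Z_q * 'Z_q) : Hvertex 2 q :=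
  [ffun i => if i == ord0 then p.1 else p.2].

Definition hcoord (q : nat) (x : Hvertex 2 q) : 'Z_q * 'Z_q := (x ord0, x ord_max).

Lemma hpairK (q : nat) : cancel (@hpair q) (@hcoord q).
Proof. by case=> a b; rewrite /hcoord !ffunE. Qed.

Lemma hcoordK (q : nat) : cancel (@hcoord q) (@hpair q).
Proof.
move=> x; apply/ffunP => i; rewrite ffunE.
by case: eqP => [->//|/eqP ni] /=; congr (x _); apply/val_inj; case: i ni => [[|[|]]].
Qed.

Lemma Hadj_hpair (q : nat) (p p' : 'Z_q * 'Z_q) :
  @Hadj 2 q 2 (hpair q p) (hpair q p') = diffboth p p'.
Proof.
rewrite /Hadj /diffboth -sum1dep_card big_mkcond !big_ord_recl big_ord0 /= !ffunE /=.
by do 2!case: (_ != _).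
Qed.

Theorem theorem1p8 (q : nat) (hq : 3 <= q) :
  (forall U : {set Hvertex 2 q},
     2 * q <= #|U| -> 2 <= VCdim U (nbhds (@Hadj 2 q 2) U)) /\
  (exists U : {set Hvertex 2 q},
     #|U| = 2 * q - 1 /\ VCdim U (nbhds (@Hadj 2 q 2) U) < 2).
Proof.
have cZ : #|'Z_q| = q by rewrite card_ord Zp_cast // (leq_trans _ hq).
have transport U := @VCdim_ge2_preim _ _ _ _ _ _ U (hpairK q) (hcoordK q) (Hadj_hpair q).
split=> [U cU|].
  rewrite -transport; apply: VCdim_grid_ge2; rewrite ?cZ //.
  rewrite on_card_preimset //.
  by exists (hcoord q) => x _; [apply: hpairK | apply: hcoordK].
exists (hcoord q @^-1: cross 0%R 0%R); split.
  rewrite on_card_preimset; first by rewrite card_cross cZ addnn -mul2n subn1.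
  by exists (hpair q) => x _; [apply: hcoordK | apply: hpairK].
rewrite ltnNge -transport -ltnNge.
have -> : hpair q @^-1: (hcoord q @^-1: cross 0%R 0%R) = cross 0%R 0%R.
  by apply/setP => p; rewrite 2!in_set hpairK.
exact: VCdim_cross_lt2.
Qed.
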